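(* Let $\mathbf{x}=(x_1,x_2,\dots)$ be an infinite sequence of variables, and define the polynomials $$o_k(\mathbf{x}) := \frac{\prod_{j=1}^{k} \Bigl( x_j \prod_{i=1}^{j-1} (x_i-x_j)(x_i+x_j)\Bigr)}{1!\cdot 3!\cdots (2k-1)!},\qquad e_k(\mathbf{x}) := \frac{\prod_{j=1}^{k}\prod_{i=1}^{j-1}(x_i-x_j)(x_i+x_j-1)}{0!\cdot 2!\cdots(2k-2)!}.$$ Let $O(x_1,\dots,x_k)$ (for $k\ge 0$) denote the number of halved Gelfand--Tsetlin patterns with exactly $2k+1$ rows and bottom row $(x_1,\dots,x_k)$, and let $E(x_1,\dots,x_k)$ (for $k\ge 1$) denote the number of halved Gelfand--Tsetlin patterns with exactly $2k$ rows and bottom row $(x_1,\dots,x_k)$. Then for all integers $x_1>x_2>\dots>x_k>0$, $$O(x_1,x_2,\dots,x_k)=o_k(\mathbf{x})\ \text{ for every } k\ge 0\qquad\text{and}\qquad E(x_1,x_2,\dots,x_k)=e_k(\mathbf{x})\ \text{ for every } k\ge 1 .$$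
   Context: A halved Gelfand--Tsetlin pattern with $n\ge 1$ rows is an array of positive integers $x_{i,j}$, indexed by $1\le i\le n$ and $1\le j\le \lfloor i/2\rfloor$ (so row $i$ has $\lfloor i/2\rfloor$ entries, and row $1$ is empty), such that for each $i$ with $2\le i\le n$ the rows $i-1$ and $i$ are interlaced as follows. - If $i=2m+1$ is odd: $$0< x_{2m,m}\le x_{2m+1,m}<x_{2m,m-1}\le x_{2m+1,m-1}<\dots<x_{2m,1}\le x_{2m+1,1},$$ i.e. $0<x_{2m,m}$, $x_{2m,j}\le x_{2m+1,j}$ for $1\le j\le m$, and $x_{2m+1,j+1}<x_{2m,j}$ for $1\le j\le m-1$. - If $i=2m$ is even: $$x_{2m,m}\le x_{2m-1,m-1}<x_{2m,m-1}\le x_{2m-1,m-2}<\dots\le x_{2m-1,1}<x_{2m,1},$$ i.e. $x_{2m,j+1}\le x_{2m-1,j}<x_{2m,j}$ for $1\le j\le m-1$ (no condition when $m=1$). The bottom row of such a pattern is $(x_{n,1},x_{n,2},\dots,x_{n,\lfloor n/2\rfloor})$. For $n=1$ there is exactly one pattern (with empty bottom row), so $O$ of the empty row equals $1$. Empty products equal $1$. *)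

(* Defs.v *)
From mathcomp Require Import all_boot all_order all_algebra.
From mathcomp Require Import finmap mpoly.
From mathcomp Require Import boolp classical_sets functions cardinality.

Set Implicit Arguments.
Unset Strict Implicit.
Unset Printing Implicit Defensive.

Import GRing.Theory.

Local Open Scope ring_scope.

(* A triangular array is the list of its rows, row i sitting at list position
   i - 1; rows and columns are numbered from 1, as in x_{i,j}. *)
Definition prow (p : seq (seq nat)) (i : nat) : seq nat := nth [::] p i.-1.

Definition entry (p : seq (seq nat)) (i j : nat) : nat := nth 0%N (prow p i) j.-1.

Definition odd_interlaced (p : seq (seq nat)) (m : nat) : Prop :=
  [/\ (0 < entry p m.*2 m)%N,
      forall j, (1 <= j <= m)%N -> (entry p m.*2 j <= entry p m.*2.+1 j)%N
    & forall j, (1 <= j < m)%N -> (entry p m.*2.+1 j.+1 < entry p m.*2 j)%N].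

Definition even_interlaced (p : seq (seq nat)) (m : nat) : Prop :=
  forall j, (1 <= j < m)%N ->
    (entry p m.*2 j.+1 <= entry p m.*2.-1 j < entry p m.*2 j)%N.

(* The shape condition makes the list of rows determined by the entries x_{i,j}
   with 1 <= i <= n and 1 <= j <= i./2, so that counting lists counts arrays. *)
Definition halved_GT (n : nat) (p : seq (seq nat)) : Prop :=
  [/\ shape p = [seq i./2 | i <- iota 1 n],
      forall i j, (1 <= i <= n)%N -> (1 <= j <= i./2)%N -> (0 < entry p i j)%N,
      forall m, (0 < m)%N -> (m.*2.+1 <= n)%N -> odd_interlaced p m
    & forall m, (0 < m)%N -> (m.*2 <= n)%N -> even_interlaced p m].

Definition halved_GT_bottom (n : nat) (b : seq nat) : set (seq (seq nat)) :=
  [set p | halved_GT n p /\ prow p n = b]%classic.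

(* [fset_set] is empty on infinite sets, but no entry of a pattern exceeds the
   largest entry of its bottom row, so the sets counted here are finite. *)
Definition numO (k : nat) (b : k.-tuple nat) : nat :=
  #|` fset_set (halved_GT_bottom k.*2.+1 b)|.

Definition numE (k : nat) (b : k.-tuple nat) : nat :=
  #|` fset_set (halved_GT_bottom k.*2 b)|.

(* Only the first k variables occur in o_k and e_k; the variable x_j is 'X_(j-1),
   which turns the factorials (2j-1)! and (2j-2)! into (2j+1)! and (2j)!. *)
Definition opoly (k : nat) : {mpoly rat[k]} :=
  (\prod_(j < k) ((j.*2.+1)`!)%:R)^-1 *:
  \prod_(j < k) ('X_j * \prod_(i < k | (i < j)%N) (('X_i - 'X_j) * ('X_i + 'X_j))).

Definition epoly (k : nat) : {mpoly rat[k]} :=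
  (\prod_(j < k) ((j.*2)`!)%:R)^-1 *:
  \prod_(j < k) \prod_(i < k | (i < j)%N)
    (('X_i - 'X_j) * ('X_i + 'X_j - 1)).

(* Main.v *)
Require Import Defs.
From mathcomp Require Import all_boot all_order all_algebra perm.
From mathcomp Require Import mpoly finmap.
From mathcomp Require Import boolp classical_sets cardinality.
From mathcomp Require Import ring zify.

(** Deleting the bottom row [b] of a pattern leaves a pattern with one row
    less, and the interlacing conditions let each entry of the new bottom row
    range independently over an interval cut out by two consecutive entries
    of [b] (with a final 0 added to [b] when its row number is odd).  So the
    number of patterns satisfies a recursion in which a count is summed over
    a box.  It remains to see that the product formulas obey the same
    recursion, which becomes visible once they are written as determinants.

    Put f_j(x) = binom(x + j, 2j + 1) and g_j(x) = binom(x + j - 1, 2j), that is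
      f_j(x) = x (x^2 - 1^2) ... (x^2 - j^2) / (2j + 1)!,
      g_j(x) = (x(x-1) - 1*0) (x(x-1) - 2*1) ... (x(x-1) - j(j-1)) / (2j)!.
    The first is x times a polynomial of degree j in x^2, the second is a
    polynomial of degree j in x(x-1).  A Vandermonde determinant gives
      o_k = det (f_(k-j) (x_i)) and e_k = det (g_(k-j) (x_i)), 1 <= i, j <= k
    ([odd_detE], [even_detE]), since x^2 - y^2 = (x - y)(x + y) and
    x(x-1) - y(y-1) = (x - y)(x + y - 1).  Pascal's rule reads
      f_j(x) - f_j(x-1) = g_j(x),  g_(j+1)(x+1) - g_(j+1)(x) = f_j(x)
    ([odd_basis_diff], [even_basis_diff]).  Summing a determinant over a box
    sums each row separately, and these sums telescope; hence summing e_k (or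
    o_k) over the rows allowed above [b] gives the determinant whose rows are
    differences of the values of f (or g) at consecutive entries of [b].  For
    f the entry after the last one is 0, where f vanishes, and row operations
    remove the differences.  For g the constant g_0 = 1 supplies a column of
    ones, by which the differences turn into a determinant of size one more.
    These are [sum_even_det] and [sum_odd_det], and the theorem follows by
    induction on the number of rows. *)

Set Implicit Arguments.
Unset Strict Implicit.
Unset Printing Implicit Defensive.
Import GRing.Theory Num.Theory.
Local Open Scope ring_scope.

(** * Cartesian products of lists *)

Fixpoint cart (ss : seq (seq nat)) : seq (seq nat) :=
  if ss is s :: ss' then [seq x :: z | x <- s, z <- cart ss'] else [:: [::]].

Lemma mem_cart ss z :
  reflect (size z = size ss /\
           forall i, (i < size ss)%N -> nth 0%N z i \in nth [::] ss i)
          (z \in cart ss).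
Proof.
elim: ss z => [|s ss IH] z /=.
  by rewrite inE; apply: (iffP eqP) => [-> | [/size0nil]].
apply: (iffP allpairsPdep) => [[x [w [xs /IH[sw wP] ->]]] | [sz zP]].
  by split=> [|[|i]] //=; [rewrite sw | apply: wP].
case: z sz zP => // x w [sw] zP; exists x, w; split=> //; first exact: (zP 0%N).
by apply/IH; split=> // i; apply: (zP i.+1).
Qed.

Lemma cart_uniq ss : all uniq ss -> uniq (cart ss).
Proof.
elim: ss => //= s ss IH /andP[us uss].
by apply: allpairs_uniq; rewrite ?IH // => -[? ?] [? ?] _ _ [-> ->].
Qed.

(** * Determinants *)

Section Det.

Variable R : comNzRingType.

(** Subtracting from each row the next one is multiplication by a unitriangular
    matrix; the last row has nothing below it, which is the row [v k = 0]. *)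
Lemma det_row_differences k (v : nat -> nat -> R) :
    (forall j, (j < k)%N -> v k j = 0) ->
  \det (\matrix_(i < k, j < k) (v i j - v i.+1 j)) =
  \det (\matrix_(i < k, j < k) v i j).
Proof.
move=> vk0.
pose U : 'M[R]_k := \matrix_(i, l) ((l == i)%:R - (l == i.+1 :> nat)%:R).
have detU : \det U = 1.
  rewrite -det_tr det_trig; last first.
    apply/is_trig_mxP => i j ltij; rewrite !mxE.
    rewrite -val_eqE /= ltn_eqF // ltn_eqF ?subr0 //.
    exact: ltnW.
  by apply: big1 => i _; rewrite !mxE eqxx ltn_eqF ?subr0.
rewrite -[RHS]mul1r -detU -det_mulmx; congr (\det _).
apply/matrixP => i j; rewrite !mxE.
under [RHS]eq_bigr do rewrite !mxE mulrBl.
rewrite sumrB (bigD1 i) //= eqxx mul1r big1 ?addr0; last first.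
  by move=> l /negPf->; rewrite mul0r.
congr (_ - _); have [lt_ik | le_ki] := ltnP i.+1 k.
  rewrite (bigD1 (Ordinal lt_ik)) //= eqxx mul1r big1 ?addr0 //.
  by move=> l /negPf; rewrite -val_eqE /= => ->; rewrite mul0r.
have -> : i.+1 = k by apply/eqP; rewrite eqn_leq le_ki ltn_ord.
rewrite vk0 // big1 // => l _.
by rewrite ltn_eqF ?ltn_ord // mul0r.
Qed.

(** Differences of consecutive rows cancel the column of ones except in its
    last entry, so expanding along that column drops the last row. *)
Lemma det_bordered_differences k (u : nat -> nat -> R) :
    (forall i, (i <= k)%N -> u i k = 1) ->
  \det (\matrix_(i < k.+1, j < k.+1) u i j) =
  \det (\matrix_(i < k, j < k) (u i j - u i.+1 j)).
Proof.
move=> uk1.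
(* A zero row below the matrix makes the difference in the last row trivial. *)
pose v i j : R := if (i <= k)%N then u i j else 0.
transitivity (\det (\matrix_(i < k.+1, j < k.+1) v i j)).
  by congr (\det _); apply/matrixP => i j; rewrite !mxE /v -ltnS ltn_ord.
rewrite -det_row_differences; last by move=> j _; rewrite /v ltnn.
rewrite (expand_det_col _ ord_max) big_ord_recr /= big1 ?add0r; last first.
  move=> i _; rewrite !mxE /v /= ltn_ord ltnW ?ltn_ord //.
  by rewrite !uk1 ?ltn_ord 1?ltnW ?ltn_ord // subrr mul0r.
rewrite !mxE /v /= leqnn ltnn uk1 // subr0 mul1r.
rewrite /cofactor addnn -signr_odd odd_double mul1r.
congr (\det _); apply/matrixP => i j.
by rewrite !mxE !lift_max ltn_ord (ltnW (ltn_ord i)).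
Qed.

(** The matrix is the product of a Vandermonde matrix and the triangular matrix
    of coefficients.  The columns are listed by decreasing degree because the
    differences [t i - t j] with [i < j] then appear without a sign. *)
Lemma det_poly_Vandermonde (k : nat) (P : nat -> {poly R}) (t : 'I_k -> R) :
    (forall j, (size (P j) <= j.+1)%N) ->
  \det (\matrix_(i < k, j < k) (P (rev_ord j)).[t i]) =
  (\prod_(j < k) (P j)`_j) * \prod_(j < k) \prod_(i < k | (i < j)%N) (t i - t j).
Proof.
move=> sP.
pose W : 'M[R]_k := \matrix_(i, l) t i ^+ rev_ord l.
pose C : 'M[R]_k := \matrix_(l, j) (P (rev_ord j))`_(rev_ord l).
have -> : \matrix_(i < k, j < k) (P (rev_ord j)).[t i] = W *m C.
  apply/matrixP => i j; rewrite !mxE (@horner_coef_wide _ k); last first.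
    exact: leq_trans (sP _) (ltn_ord _).
  rewrite (reindex_inj rev_ord_inj) /=; apply: eq_bigr => l _.
  by rewrite !mxE mulrC.
rewrite det_mulmx mulrC; congr (_ * _).
  rewrite det_trig.
    rewrite [RHS](reindex_inj rev_ord_inj); apply: eq_bigr => j _.
    by rewrite !mxE.
  apply/is_trig_mxP => l j ltlj; rewrite !mxE nth_default //.
  apply: leq_trans (sP _) _; rewrite /= ltn_sub2l ?ltnS //.
  exact: leq_trans (ltn_ord j).
(* Reversing both rows and columns leaves the determinant unchanged. *)
pose s := perm (@rev_ord_inj k).
pose V := Vandermonde k (\row_j t (rev_ord j)).
have -> : W = col_perm s (row_perm s V^T).
  by apply/matrixP => i l; rewrite !mxE !permE rev_ordK.
rewrite col_permE row_permE !det_mulmx det_tr !det_perm mulrAC.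
rewrite odd_permV -expr2 sqrr_sign mul1r det_Vandermonde.
rewrite (reindex_inj rev_ord_inj); apply: eq_bigr => j _.
rewrite (reindex_inj rev_ord_inj).
apply: eq_big => i; last by rewrite !mxE !rev_ordK.
by rewrite /= ltn_sub2lE ?ltn_ord.
Qed.

(** The case of Newton polynomials, whose roots are initial segments of one
    sequence; [odd_basis] (up to a factor [x]) and [even_basis] have this form
    in the variables [x ^+ 2] and [x * (x - 1)]. *)
Lemma det_root_products (k : nat) (c r : nat -> R) (t : 'I_k -> R) :
  \det (\matrix_(i < k, j < k)
          (c (rev_ord j) * \prod_(l < rev_ord j) (t i - r l))) =
  (\prod_(j < k) c j) * \prod_(j < k) \prod_(i < k | (i < j)%N) (t i - t j).
Proof.
pose P j : {poly R} := c j *: \prod_(l < j) ('X - (r l)%:P).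
have sP j : size (\prod_(l < j) ('X - (r l)%:P)) = j.+1.
  by rewrite size_prod_XsubC /index_enum -enumT size_enum_ord.
have Pj j : (P j)`_j = c j.
  rewrite coefZ.
  have /monicP := monic_prod_XsubC (index_enum 'I_j) xpredT (fun l => r l).
  by rewrite /lead_coef sP => ->; rewrite mulr1.
transitivity (\det (\matrix_(i < k, j < k) (P (rev_ord j)).[t i])).
  congr (\det _); apply/matrixP => i j; rewrite !mxE hornerZ horner_prod.
  by congr (_ * _); apply: eq_bigr => l _; rewrite hornerXsubC.
rewrite det_poly_Vandermonde.
  by congr (_ * _); apply: eq_bigr => j _; apply: Pj.
by move=> j; rewrite (leq_trans (size_scale_leq _ _)) ?sP.
Qed.

Lemma sum_cart_prod ss (F : nat -> nat -> R) :
  \sum_(z <- cart ss) \prod_(i < size ss) F i (nth 0%N z i) =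
  \prod_(i < size ss) \sum_(x <- nth [::] ss i) F i x.
Proof.
elim: ss F => [|s ss IH] F /=; first by rewrite big_seq1 !big_ord0.
rewrite big_allpairs_dep /= big_ord_recl /= mulr_suml.
apply: eq_bigr => x _; rewrite -(IH (fun i => F i.+1)) mulr_sumr.
by apply: eq_bigr => z _; rewrite big_ord_recl.
Qed.

(** A determinant is linear in each row, so the sum over independently chosen
    rows is the determinant of the summed rows. *)
Lemma sum_cart_det k ss (h : nat -> 'I_k -> R) : size ss = k ->
  \sum_(z <- cart ss) \det (\matrix_(i < k, j < k) h (nth 0%N z i) j) =
  \det (\matrix_(i < k, j < k) \sum_(x <- nth [::] ss i) h x j).
Proof.
move=> sk; rewrite exchange_big /=; apply: eq_bigr => s _.
rewrite -mulr_sumr; congr (_ * _).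
(* Off the range of row indices the value is arbitrary. *)
pose F (i x : nat) := if insub i is Some i' then h x (s i') else 0.
transitivity (\sum_(z <- cart ss) \prod_(i < size ss) F i (nth 0%N z i)).
  apply: eq_bigr => z _; rewrite sk; apply: eq_bigr => i _.
  by rewrite mxE /F valK.
rewrite sum_cart_prod sk; apply: eq_bigr => i _; rewrite mxE.
by apply: eq_bigr => x _; rewrite /F valK.
Qed.

End Det.

(** * Two bases of polynomials and their differences *)

Section Bases.

Variable R : comNzRingType.

(** (2j + 1)! binom(x + j, 2j + 1), written to show that it is [x] times a
    polynomial in [x ^+ 2]. *)
Definition odd_prod (j : nat) (x : R) : R :=
  x * \prod_(l < j) (x ^+ 2 - l.+1%:R ^+ 2).

(** (2j)! binom(x + j - 1, 2j), written as a polynomial in [x * (x - 1)]: its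
    roots come in pairs l + 1 and - l. *)
Definition even_prod (j : nat) (x : R) : R :=
  \prod_(l < j) (x * (x - 1) - l.+1%:R * l%:R).

(** As falling factorials the two products share all factors but one.  Together
    with its shifted form below, this gives both difference equations. *)
Lemma odd_prodE j x : odd_prod j x = even_prod j x * (x + j%:R).
Proof.
rewrite /odd_prod /even_prod; elim: j => [|j IH].
  by rewrite !big_ord0; ring.
by rewrite !big_ord_recr /= mulrA IH -natr1; ring.
Qed.

Lemma odd_prod_pred j x : odd_prod j (x - 1) = even_prod j x * (x - 1 - j%:R).
Proof.
rewrite /odd_prod /even_prod; elim: j => [|j IH].
  by rewrite !big_ord0; ring.
by rewrite !big_ord_recr /= mulrA IH -natr1; ring.
Qed.

Lemma odd_prod_diff j x :
  odd_prod j x - odd_prod j (x - 1) = j.*2.+1%:R * even_prod j x.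
Proof. by rewrite odd_prodE odd_prod_pred -natr1 -muln2 natrM; ring. Qed.

Lemma even_prod_diff j x :
  even_prod j.+1 (x + 1) - even_prod j.+1 x = j.+1.*2%:R * odd_prod j x.
Proof.
have -> : even_prod j.+1 x = odd_prod j x * (x - 1 - j%:R).
  rewrite /even_prod big_ord_recr /= -/(even_prod j x) odd_prodE.
  by rewrite -natr1; ring.
have -> : even_prod j.+1 (x + 1) = odd_prod j x * (x + j.+1%:R).
  rewrite /even_prod big_ord_recr /= -/(even_prod j (x + 1)).
  have := odd_prod_pred j (x + 1); rewrite addrK => ->.
  by rewrite -natr1; ring.
by rewrite -muln2 natrM -natr1; ring.
Qed.

End Bases.

Definition odd_basis (j : nat) (x : rat) : rat := odd_prod j x / (j.*2.+1)`!%:R.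
Definition even_basis (j : nat) (x : rat) : rat := even_prod j x / (j.*2)`!%:R.

Lemma odd_basis_diff j x :
  odd_basis j x - odd_basis j (x - 1) = even_basis j x.
Proof.
rewrite /odd_basis -mulrBl odd_prod_diff factS natrM.
by rewrite -mulf_div divff ?mul1r ?pnatr_eq0.
Qed.

Lemma even_basis_diff j x :
  even_basis j.+1 (x + 1) - even_basis j.+1 x = odd_basis j x.
Proof.
rewrite /even_basis -mulrBl even_prod_diff doubleS factS natrM.
by rewrite -mulf_div divff ?mul1r ?pnatr_eq0.
Qed.

(** * The rows that interlace a given row *)

(** Entries beyond the end of [b] read as 0, so for the last index this says
    that the last entry is positive. *)
Definition decr (b : seq nat) :=
  forall i, (i < size b)%N -> (nth 0%N b i.+1 < nth 0%N b i)%N.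

(** The candidates for row [n] above a row [b] numbered [n.+1].  Both parities
    are covered by one formula: intervals closed on the left and open on the
    right when [n] is odd, and shifted by one when [n] is even.  In the even
    case the lower bound for the last entry comes from the 0 read beyond the
    end of [b]. *)
Definition rows_above (n : nat) (b : seq nat) : seq (seq nat) :=
  cart [seq index_iota (nth 0%N b i.+1 + ~~ odd n)%N (nth 0%N b i + ~~ odd n)%N
       | i <- iota 0 n./2].

Lemma mem_rows_above n b z :
  reflect (size z = n./2 /\ forall i, (i < n./2)%N ->
             (nth 0 b i.+1 + ~~ odd n <= nth 0 z i < nth 0 b i + ~~ odd n)%N)
          (z \in rows_above n b).
Proof.
apply: (iffP (mem_cart _ _)); rewrite !size_map size_iota => -[sz zP];
  split=> // i lt_i.
  have := zP i lt_i.
  by rewrite (nth_map 0%N) ?size_iota // nth_iota // mem_index_iota.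
by rewrite (nth_map 0%N) ?size_iota // nth_iota // mem_index_iota zP.
Qed.

Lemma rows_above_decr n b z : size b = n.+1./2 -> decr b ->
  z \in rows_above n b -> size z = n./2 /\ decr z.
Proof.
move=> sb db /mem_rows_above[sz zP]; split=> // i; rewrite sz => lt_i.
have /andP[lo hi] := zP i lt_i.
case: (ltnP i.+1 n./2) => [lt_i1 | le_i1].
  by have /andP[_ hi'] := zP _ lt_i1; apply: leq_trans hi' lo.
rewrite [nth 0%N z i.+1]nth_default ?sz //; apply: leq_trans lo.
case: (boolP (odd n)) => on /=; last by lia.
by have := db i.+1; rewrite sb => /(_ _); lia.
Qed.

(** * The determinants satisfy the recursion *)

Definition odd_det (k : nat) (z : seq nat) : rat :=
  \det (\matrix_(i < k, j < k) odd_basis (rev_ord j) (nth 0%N z i)%:R).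
Definition even_det (k : nat) (z : seq nat) : rat :=
  \det (\matrix_(i < k, j < k) even_basis (rev_ord j) (nth 0%N z i)%:R).

(** The entry read beyond the end of [b] is 0, where [odd_basis] vanishes, so
    the telescoped differences leave the determinant unchanged. *)
Lemma sum_even_det k b : size b = k -> decr b ->
  \sum_(z <- rows_above k.*2 b) even_det k z = odd_det k b.
Proof.
move=> sb db; rewrite /rows_above doubleK odd_double /=.
rewrite (@sum_cart_det _ k _ (fun x j => even_basis (rev_ord j) x%:R));
  last by rewrite !size_map size_iota.
pose v (i j : nat) := odd_basis (k - j.+1) (nth 0%N b i)%:R.
rewrite -[RHS](@det_row_differences _ k v); last first.
  by move=> j _; rewrite /v nth_default ?sb // /odd_basis /odd_prod !mul0r.
congr (\det _); apply/matrixP => i j; rewrite !mxE.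
rewrite (nth_map 0%N) ?size_iota // nth_iota // add0n.
have le_b : (nth 0 b i.+1 <= nth 0 b i)%N by apply/ltnW/db; rewrite sb.
rewrite (@telescope_sumr_eq _ _ _ (fun x => odd_basis (rev_ord j) (x%:R - 1))).
- by rewrite !natrD !addrK.
- by rewrite leq_add2r.
by move=> x _; rewrite -natr1 addrK -odd_basis_diff.
Qed.

(** The constant [even_basis 0] provides the column of ones that the telescoped
    differences have lost. *)
Lemma sum_odd_det k b : size b = k.+1 -> decr b ->
  \sum_(z <- rows_above k.*2.+1 b) odd_det k z = even_det k.+1 b.
Proof.
move=> sb db; rewrite /rows_above /= uphalf_double odd_double /=.
rewrite (@sum_cart_det _ k _ (fun x j => odd_basis (rev_ord j) x%:R));
  last by rewrite !size_map size_iota.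
pose u (i j : nat) := even_basis (k - j) (nth 0%N b i)%:R.
rewrite [RHS](@det_bordered_differences _ k u); last first.
  by move=> i _; rewrite /u subnn /even_basis /even_prod big_ord0 divr1.
congr (\det _); apply/matrixP => i j; rewrite !mxE.
rewrite (nth_map 0%N) ?size_iota // nth_iota // add0n !addn0.
rewrite (@telescope_sumr_eq _ _ _ (fun x => even_basis (k - j) x%:R)) //.
  by apply/ltnW/db; rewrite sb ltnS ltnW.
by move=> x _; rewrite -natr1 -(subnSK (ltn_ord j)) even_basis_diff.
Qed.

(** * Enumerating patterns *)

(** Patterns with [n.+1] rows and bottom row [b]. *)
Fixpoint patterns (n : nat) (b : seq nat) : seq (seq (seq nat)) :=
  if n is n'.+1 then [seq rcons p b | z <- rows_above n b, p <- patterns n' z]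
  else [:: [:: b]].

(** The parities look exchanged because the number of rows is [n.+1]. *)
Lemma size_patterns n b : size b = n.+1./2 -> decr b ->
  (size (patterns n b))%:R =
  if odd n then even_det n.+1./2 b else odd_det n.+1./2 b.
Proof.
elim: n b => [|n IH] b sb db; first by rewrite /= /odd_det det_mx00.
rewrite [patterns _ _]/= size_allpairs_dep sumnE big_map natr_sum.
rewrite -/(rows_above n.+1 b).
transitivity (\sum_(z <- rows_above n.+1 b)
    if odd n then even_det n.+1./2 z else odd_det n.+1./2 z).
  apply: eq_big_seq => z z_b; have [sz dz] := rows_above_decr sb db z_b.
  exact: IH.
have := odd_double_half n; move: (n./2) => m def_n.
case: (boolP (odd n)) def_n => on /= def_n; move: sb;
  rewrite -def_n ?add0n ?add1n /=.
  rewrite uphalf_double odd_double doubleK => sb.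
  exact: (@sum_even_det m.+1).
by rewrite doubleK uphalf_double odd_double => sb; apply: sum_odd_det.
Qed.

(** The bottom row can be read off a pattern, so that the lists obtained from
    different rows above [b] are disjoint. *)
Lemma last_patterns n b p : p \in patterns n b -> last [::] p = b.
Proof.
case: n => [|n] /=; first by rewrite inE => /eqP->.
by case/allpairsPdep=> z [q [_ _ ->]]; rewrite last_rcons.
Qed.

Lemma patterns_uniq n b : uniq (patterns n b).
Proof.
elim: n b => //= n IH b; apply: allpairs_uniq_dep => [|z _|[z p] [w q]] //=.
  by apply: cart_uniq; apply/allP => s /mapP[i _ ->]; apply: iota_uniq.
move=> /allpairsPdep[z' [p' [_ p'z' [-> ->]]]].
move=> /allpairsPdep[w' [q' [_ q'w' [-> ->]]]].
case/rcons_inj=> def_p; move: p'z'.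
by rewrite def_p => /last_patterns <-; rewrite (last_patterns q'w').
Qed.

Lemma prow_rcons p b i : (0 < i <= size p)%N -> prow (rcons p b) i = prow p i.
Proof. by case: i => // i /andP[_ lt_i]; rewrite /prow nth_rcons lt_i. Qed.

(** Row [n.+1] and row [n.+2] are related by one of the two interlacing
    conditions, depending on parity.  For an odd row [n.+2] the separate
    positivity requirement is the lower bound at the last index, read with the
    default 0 of [b]. *)
Lemma interlaced_rows_above n p b (s := rcons p b) : size p = n.+1 ->
    size (prow p n.+1) = n.+1./2 -> size b = n.+2./2 ->
  (prow p n.+1 \in rows_above n.+1 b) <->
  (if odd n.+1 then even_interlaced s n.+2./2
   else odd_interlaced s n.+1./2).
Proof.
move=> sp sz sb; set z := prow p n.+1 in sz *.
have s1 i : entry s n.+1 i = nth 0%N z i.-1.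
  by rewrite /entry prow_rcons // sp leqnn.
have s2 i : entry s n.+2 i = nth 0%N b i.-1.
  by rewrite /entry /prow nth_rcons sp ltnn eqxx.
apply: (iff_trans (iff_sym (rwP (mem_rows_above _ _ _)))).
have := odd_double_half n.+1; case: (boolP (odd n.+1)) => on /= def_n.
  rewrite /even_interlaced.
  have e2 : n./2.+1.*2 = n.+2 by move: def_n; rewrite /= in on *; lia.
  rewrite e2 [n.+2.-1]/= .
  split=> [[_ zP] [|j] // |zP].
    by rewrite s1 !s2 /= => lt_j; have := zP j; rewrite !addn0; apply; lia.
  split=> // j lt_j; have := zP j.+1.
  by rewrite s1 !s2 /= !addn0; apply; lia.
have e2 : (n.+1)./2.*2 = n.+1 by exact: def_n.
rewrite /odd_interlaced e2.
have m_gt0 : (0 < uphalf n)%N by lia.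
split=> [[_ zP] | [z0 z1 z2]].
  split=> [|[|j] // lt_j|[|j] // lt_j]; rewrite s1 ?s2 /=.
  - have := zP (uphalf n).-1.
    by case: (uphalf n) m_gt0 => //= m _ /(_ (leqnn _)); lia.
  - by case/andP: lt_j => _ /zP; lia.
  by case/andP: lt_j => _ /ltnW/zP; lia.
split=> // i lt_i.
apply/andP; split.
  have := z2 i.+1; have := z0; rewrite !s1 s2 /=.
  case: (ltnP i.+1 (uphalf n)) => [lt_i1 _ | le_i].
    by move=> /(_ isT); lia.
  rewrite [nth 0%N b _]nth_default ?sb /=; last by lia.
  have -> : (uphalf n).-1 = i by rewrite /= in lt_i; lia.
  by lia.
by have := z1 i.+1; rewrite s1 s2 /=; rewrite /= in lt_i; lia.
Qed.

(** A new bottom row adds a single interlacing condition; its length and the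
    positivity of its entries come from the hypotheses on [b]. *)
Lemma halved_GT_rcons n p b : size b = n.+2./2 -> decr b ->
  halved_GT n.+2 (rcons p b) <->
  halved_GT n.+1 p /\ prow p n.+1 \in rows_above n.+1 b.
Proof.
move=> sb db; set s := rcons p b.
have b_gt0 j : (j < size b)%N -> (0 < nth 0%N b j)%N.
  by move=> /db; apply: leq_ltn_trans.
have shape_s : shape s = [seq i./2 | i <- iota 1 n.+2] <->
               shape p = [seq i./2 | i <- iota 1 n.+1].
  have -> : iota 1 n.+2 = rcons (iota 1 n.+1) n.+2.
    by have := iotaD 1 n.+1 1; rewrite addn1 add1n cats1.
  rewrite /shape !map_rcons -sb.
  by split=> [/rcons_inj[] | ->].
suff ext : shape p = [seq i./2 | i <- iota 1 n.+1] ->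
    halved_GT n.+2 s <->
    halved_GT n.+1 p /\ prow p n.+1 \in rows_above n.+1 b.
  split=> [hs | [hp pb]]; apply/ext => //; first by case: hs => /shape_s.
  by case: hp.
move=> shape_p.
have sp : size p = n.+1.
  by have := congr1 size shape_p; rewrite !size_map size_iota.
have sz : size (prow p n.+1) = n.+1./2.
  have : nth 0%N (shape p) n = nth 0%N [seq i./2 | i <- iota 1 n.+1] n.
    by rewrite shape_p.
  by rewrite (nth_map [::]) ?sp // (nth_map 0%N _ half) ?size_iota // nth_iota.
have entryE i j : (0 < i <= n.+1)%N -> entry s i j = entry p i j.
  by rewrite -sp => ?; rewrite /entry prow_rcons.
have oddE m : (0 < m)%N -> (m.*2.+1 <= n.+1)%N ->
    odd_interlaced s m <-> odd_interlaced p m.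
  move=> m_gt0 le_m; rewrite /odd_interlaced entryE; last by lia.
  by split=> -[? le_row lt_row]; split=> // j lt_j;
    have := le_row j; have := lt_row j; rewrite !entryE; lia.
have evenE m : (0 < m)%N -> (m.*2 <= n.+1)%N ->
    even_interlaced s m <-> even_interlaced p m.
  move=> m_gt0 le_m; rewrite /even_interlaced.
  by split=> H j lt_j; have := H j lt_j; rewrite !entryE //; lia.
have last_row := interlaced_rows_above sp sz sb; rewrite -/s in last_row.
split=> [[_ pos_s odd_s even_s] | [[_ pos_p odd_p even_p] /last_row interl]].
  split; last first.
    apply/last_row; case: ifPn => on.
      by apply: even_s => //; have := odd_double_half n.+2; lia.
    by apply: odd_s => //; have := odd_double_half n.+1; lia.
  split=> // [i j le_i le_j | m gt0 le_m | m gt0 le_m].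
  - by rewrite -entryE //; apply: pos_s; lia.
  - by apply/oddE => //; apply: odd_s => //; lia.
  by apply/evenE => //; apply: even_s => //; lia.
split=> [|i j|m m_gt0|m m_gt0]; first exact/shape_s.
- case/andP=> i_gt0; rewrite leq_eqVlt => /predU1P[-> le_j | lt_i le_j];
    last first.
    by rewrite entryE ?i_gt0 //; apply: pos_p; rewrite ?i_gt0.
  by rewrite /entry /prow nth_rcons sp ltnn eqxx b_gt0 // sb; lia.
- rewrite leq_eqVlt => /predU1P[e | lt_m];
    last by apply/oddE => //; apply: odd_p.
  have em : n.+1./2 = m by case: e => <-; rewrite doubleK.
  move: interl; have -> : odd n.+1 = false by case: e => <-; rewrite odd_double.
  by rewrite em.
rewrite leq_eqVlt => /predU1P[e | lt_m];
  last by apply/evenE => //; apply: even_p.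
have em : n.+2./2 = m by rewrite -e doubleK.
move: interl; have -> : odd n.+1 by rewrite -[odd _]negbK -oddS -e odd_double.
by rewrite em.
Qed.

Lemma mem_patterns n b p : size b = n.+1./2 -> decr b ->
  (p \in patterns n b) <-> (halved_GT n.+1 p /\ prow p n.+1 = b).
Proof.
elim: n b p => [|n IH] b p sb db.
  case: b sb db => // _ _; rewrite inE; split=> [/eqP-> | [[]]].
    split=> //; split=> //.
    - by case=> [|[|i]] // [|j] //; rewrite ?andbF.
    - by case.
    by case.
  by case: p => [|[|//] []].
split.
  rewrite [patterns _ _]/= -/(rows_above n.+1 b).
  case/allpairsPdep=> z [q [z_b q_z ->]].
  have [sz dz] := rows_above_decr sb db z_b.
  have /IH[//|//|hq def_z] := q_z.
  have sq : size q = n.+1.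
    by case: hq => /(congr1 size); rewrite !size_map size_iota.
  split; last by rewrite /prow nth_rcons sq ltnn eqxx.
  by apply/halved_GT_rcons; rewrite // def_z.
case: (lastP p) => [|q c] [hp def_b].
  by case: hp => /(congr1 size); rewrite !size_map size_iota.
have sq : size q = n.+1.
  by case: hp => /(congr1 size); rewrite !size_map size_iota size_rcons => -[].
move: def_b; rewrite {1}/prow nth_rcons sq ltnn eqxx => def_c.
rewrite {c}def_c in hp *.
have [hq z_b] := (halved_GT_rcons q sb db).1 hp.
have [sz dz] := rows_above_decr sb db z_b.
by apply/allpairsPdep; exists (prow q n.+1), q; split=> //; apply/IH.
Qed.

Lemma card_halved_GT_bottom n b : size b = n.+1./2 -> decr b ->
  #|` fset_set (halved_GT_bottom n.+1 b)| = size (patterns n b).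
Proof.
move=> sb db.
have -> : halved_GT_bottom n.+1 b =
          [set` [fset p | p in patterns n b]%fset]%classic.
  apply/seteqP; split=> p /=; rewrite inE /=.
    by move/(mem_patterns _ sb db).
  by move/(mem_patterns _ sb db).
by rewrite set_fsetK card_fseq undup_id // patterns_uniq.
Qed.

(** * Product formulas *)

Lemma meval_opoly (k : nat) (v : 'I_k -> rat) :
  (opoly k).@[v] = (\prod_(j < k) ((j.*2.+1)`!)%:R)^-1 *
    \prod_(j < k) (v j * \prod_(i < k | (i < j)%N) ((v i - v j) * (v i + v j))).
Proof.
rewrite mevalZ rmorph_prod; congr (_ * _); apply: eq_bigr => j _.
rewrite /= mevalM mevalXU rmorph_prod; congr (_ * _); apply: eq_bigr => i _.
by rewrite /= mevalM mevalB mevalD !mevalXU.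
Qed.

Lemma meval_epoly (k : nat) (v : 'I_k -> rat) :
  (epoly k).@[v] = (\prod_(j < k) ((j.*2)`!)%:R)^-1 *
    \prod_(j < k) \prod_(i < k | (i < j)%N) ((v i - v j) * (v i + v j - 1)).
Proof.
rewrite mevalZ rmorph_prod; congr (_ * _); apply: eq_bigr => j _.
rewrite /= rmorph_prod; apply: eq_bigr => i _.
by rewrite /= mevalM !mevalB mevalD !mevalXU meval1.
Qed.

Lemma even_detE (k : nat) (x : k.-tuple nat) :
  even_det k x = (epoly k).@[fun i : 'I_k => (tnth x i)%:R].
Proof.
pose X i : rat := (tnth x i)%:R.
rewrite meval_epoly -prodfV.
transitivity (\prod_(j < k) ((j.*2)`!)%:R^-1 * \prod_(j < k)
    \prod_(i < k | (i < j)%N) (X i * (X i - 1) - X j * (X j - 1))).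
  rewrite -(det_root_products (fun j => ((j.*2)`!)%:R^-1)
                              (fun l => l.+1%:R * l%:R)).
  congr (\det _); apply/matrixP => i j; rewrite !mxE.
  by rewrite /even_basis mulrC /even_prod /X (tnth_nth 0%N).
congr (_ * _); apply: eq_bigr => j _; apply: eq_bigr => i _.
by rewrite /X; ring.
Qed.

Lemma odd_detE (k : nat) (x : k.-tuple nat) :
  odd_det k x = (opoly k).@[fun i : 'I_k => (tnth x i)%:R].
Proof.
pose X i : rat := (tnth x i)%:R.
rewrite meval_opoly -prodfV big_split /= mulrCA.
transitivity (\prod_(j < k) X j * (\prod_(j < k) ((j.*2.+1)`!)%:R^-1 *
    \prod_(j < k) \prod_(i < k | (i < j)%N) (X i ^+ 2 - X j ^+ 2))).
  rewrite -(det_root_products (fun j => ((j.*2.+1)`!)%:R^-1)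
                              (fun l => l.+1%:R ^+ 2)).
  have -> : \prod_(j < k) X j = \det (diag_mx (\row_j X j)).
    by rewrite det_diag; apply: eq_bigr => j _; rewrite mxE.
  rewrite -det_mulmx mul_diag_mx; congr (\det _).
  apply/matrixP => i j; rewrite !mxE.
  by rewrite mulrCA mulrC /odd_basis /odd_prod /X (tnth_nth 0%N).
congr (_ * (_ * _)); apply: eq_bigr => j _; apply: eq_bigr => i _.
by rewrite /X; ring.
Qed.

Theorem theorem3p1 (k : nat) (x : k.-tuple nat)
    (hx : sorted gtn (rcons x 0%N)) :
  (numO x)%:R = (opoly k).@[fun i : 'I_k => (tnth x i)%:R] :> rat /\
  ((1 <= k)%N ->
   (numE x)%:R = (epoly k).@[fun i : 'I_k => (tnth x i)%:R] :> rat).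
Proof.
have dx : decr x.
  move=> i lt_i; have /(sortedP 0%N)/(_ i) := hx.
  by rewrite size_rcons ltnS !nth_rcons_default => /(_ lt_i).
split=> [|k_gt0].
  have sx : size x = k.*2.+1./2 by rewrite size_tuple /= uphalf_double.
  rewrite -odd_detE /numO card_halved_GT_bottom // size_patterns //.
  by rewrite odd_double -sx size_tuple.
case: k x {hx} dx k_gt0 => // k x dx _.
have sx : size x = k.*2.+2./2 by rewrite size_tuple -doubleS doubleK.
rewrite -even_detE /numE doubleS card_halved_GT_bottom // size_patterns //.
by rewrite -sx size_tuple /= odd_double.
Qed.
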